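(* Let $p=0.1\sqrt{\log n}/n$. Then with high probability there is a maximum (with respect to the number of edges) $F_5$-free subhypergraph of $G^3(n,p)$ that is not tripartite.
   Context: $G^3(n,p)$ is the random $3$-uniform hypergraph on vertex set $[n]$ in which each element of $\binom{[n]}{3}$ is an edge with probability $p$, independently. An event (depending on $n$) occurs with high probability if its probability tends to $1$ as $n\to\infty$. $F_5$ is the $3$-uniform hypergraph with vertex set $\{a,b,c,d,e\}$ and edge set $\{abc, ade, bde\}$; a hypergraph is $F_5$-free if it contains no (not necessarily induced) copy of $F_5$. A $3$-uniform hypergraph is tripartite if its vertex set can be partitioned into three classes such that every edge has exactly one vertex in each class. *)

(* Defs.v *)
From HB Require Import structures.
From mathcomp Require Import all_boot all_order all_algebra.
From mathcomp Require Import all_classical all_reals all_analysis.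
Set Implicit Arguments.
Unset Strict Implicit.
Unset Printing Implicit Defensive.
Import Order.TTheory GRing.Theory Num.Theory.
Import numFieldNormedType.Exports.
Local Open Scope ring_scope.

(* A hypergraph on the vertex set T is given by its edge set {set {set T}}. *)
Definition uniform3 (T : finType) (H : {set {set T}}) : bool :=
  [forall e in H, #|e| == 3%N].

(* A copy need not be induced: f sends edges of F to edges of H, and H may have
   further edges inside the image of f. *)
Definition contains_copy (U T : finType) (F : {set {set U}})
    (H : {set {set T}}) : bool :=
  [exists f : {ffun U -> T}, injectiveb f && [forall e in F, f @: e \in H]].

(* a, b, c, d, e are the vertices 0, 1, 2, 3, 4 of 'I_5. *)
Definition F5 : {set {set 'I_5}} :=
  let a : 'I_5 := inord 0 in let b : 'I_5 := inord 1 in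
  let c : 'I_5 := inord 2 in let d : 'I_5 := inord 3 in
  let e : 'I_5 := inord 4 in
  [set [set a; b; c]; [set a; d; e]; [set b; d; e]].

Definition F5_free (T : finType) (H : {set {set T}}) : bool :=
  ~~ contains_copy F5 H.

(* The three classes are the fibres of c; a class may be empty. *)
Definition tripartite (T : finType) (H : {set {set T}}) : bool :=
  [exists c : {ffun T -> 'I_3},
    [forall e in H, [forall i, #|[set v in e | c v == i]| == 1%N]]].

(* Maximum number of edges, as opposed to maximality under inclusion. *)
Definition maximum_F5_free (T : finType) (G H : {set {set T}}) : bool :=
  [&& H \subset G, F5_free H &
    [forall H' : {set {set T}},
      (H' \subset G) && F5_free H' ==> (#|H'| <= #|H|)%N]].

(* The law of G^3(n,p): the outcome is a 3-uniform hypergraph on 'I_n, and each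
   3-subset contributes the factor p or 1 - p, independently of the others. *)
Definition G3_weight (R : realType) (n : nat) (p : R)
    (G : {set {set 'I_n}}) : R :=
  \prod_(e : {set 'I_n} | #|e| == 3%N) (if e \in G then p else 1 - p).

Definition G3_prob (R : realType) (n : nat) (p : R)
    (A : pred {set {set 'I_n}}) : R :=
  \sum_(G : {set {set 'I_n}} | uniform3 G && A G) G3_weight p G.

Definition with_high_probability (R : realType) (p : nat -> R)
    (A : forall n, pred {set {set 'I_n}}) : Prop :=
  ((fun n => G3_prob (p n) (A n)) @ \oo --> (1 : R))%classic.

(* Main.v *)
Require Import Defs.
From mathcomp Require Import all_boot all_order all_algebra.
From mathcomp Require Import all_classical all_reals all_analysis.
From mathcomp Require Import fintype finset ring lra.
Import Order.TTheory GRing.Theory Num.Theory.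
Import numFieldNormedType.Exports.
Local Open Scope ring_scope.
Set Implicit Arguments.
Unset Strict Implicit.
Unset Printing Implicit Defensive.

(** Let [K_4^-] be the hypergraph with edges [abc], [abd], [acd]. It is not
    tripartite, since every two of its four vertices lie in a common edge and
    so need different classes. Call a copy of it in [G] isolated if [G] has no
    edge with exactly two vertices in the copy, and no two edges [xde], [yde]
    with [x], [y] in the copy and [d], [e] outside. No copy of [F_5] in [G] then
    uses an edge lying inside the isolated copy ([no_F5_edge_inside]), so every
    such edge belongs to every maximum [F_5]-free subhypergraph, which therefore
    contains the [K_4^-] and is not tripartite
    ([isolated_K4minus_nontripartite]). It remains to see that an isolated copy
    exists with high probability.

    This is a second moment argument ([second_moment]). A fixed [K_4^-] is
    present with probability [p^3]; given this, each of the [O(n)] pendant edges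
    and [O(n^2)] pairs [xde], [yde] that threaten its isolation must be avoided.
    Avoiding them are decreasing events, so by Harris' inequality ([harris]) the
    probability that all are avoided is at least the product
    [(1-p)^(16n) (1-p^2)^(16n^2)], which for [p = 0.1 sqrt(ln n)/n] is at least
    [n^(-0.32-o(1))]. With about [n^4] candidates the expected number [mu] of
    isolated copies is thus at least [n^(0.68-o(1))].

    For the second moment ([prob_two_places_le]), consider two candidates.
    If they are disjoint, their isolation events become independent once the
    threats touching both are ignored, and ignoring these changes each
    probability by a factor of only [1 - o(1)]; such pairs contribute at most
    [(1+o(1)) mu^2]. If they share exactly one vertex, both are present with
    probability [p^6], and there are [O(n^7)] such pairs, which is
    [n^(1+o(1)) = o(mu^2)]. If they share two or three vertices they cannot both
    be isolated, because some edge of one is then a threat to the other. Equal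
    pairs contribute [mu]. *)

(** * Random subsets with independent elements *)
Section RandomSubset.
Variables (R : realFieldType) (T : finType) (q : T -> R).
Implicit Types (G B C : {set T}) (f g : {set T} -> R).

Definition weight G : R := \prod_e (if e \in G then q e else 1 - q e).
Definition expect f : R := \sum_(G : {set T}) weight G * f G.
Definition prob (A : pred {set T}) : R := expect (fun G => (A G)%:R).

Lemma eq_expect f g : f =1 g -> expect f = expect g.
Proof. by move=> fg; apply: eq_bigr => G _; rewrite fg. Qed.

Lemma expectZ a f : expect (fun G => a * f G) = a * expect f.
Proof. by rewrite /expect mulr_sumr; apply: eq_bigr => G _; rewrite mulrCA. Qed.

Lemma expectD f g : expect (fun G => f G + g G) = expect f + expect g.
Proof. by rewrite /expect -big_split; apply: eq_bigr => G _; rewrite mulrDr. Qed.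

Lemma expect_sum (I : finType) (P : pred I) (F : I -> {set T} -> R) :
  expect (fun G => \sum_(i | P i) F i G) = \sum_(i | P i) expect (F i).
Proof.
rewrite /expect exchange_big; apply: eq_bigr => G _.
by rewrite mulr_sumr.
Qed.

(** Choosing, for each element, the term of the set or of its complement
    expands the product; this is how total mass and inclusion probabilities are
    computed. *)
Lemma sum_prod_set (F F' : T -> R) :
  \sum_(G : {set T}) \prod_e (if e \in G then F e else F' e)
    = \prod_e (F e + F' e).
Proof. by rewrite bigA_distr. Qed.

Lemma expect1 : expect (fun=> 1) = 1.
Proof.
rewrite /expect; under eq_bigr do rewrite mulr1.
by rewrite sum_prod_set big1 // => e _; rewrite addrC subrK.
Qed.

Lemma prob_supset C : prob (fun G => C \subset G) = \prod_(e in C) q e.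
Proof.
transitivity (\prod_e (q e + (if e \in C then 0 else 1 - q e))); last first.
  rewrite [RHS]big_mkcond; apply: eq_bigr => e _.
  by case: ifP; rewrite ?addr0 // addrC subrK.
rewrite -sum_prod_set; apply: eq_bigr => G _.
have [CG|/subsetPn[e eC eG]] := boolP (C \subset G).
  rewrite mulr1; apply: eq_bigr => e _.
  by case: ifPn => // eG; case: ifP => // /(subsetP CG); rewrite (negPf eG).
by rewrite mulr0 (bigD1 e) //= (negPf eG) eC mul0r.
Qed.

Definition mix B G G' : {set T} := (G :&: B) :|: (G' :\: B).

Lemma in_mix B G G' e :
  (e \in mix B G G') = if e \in B then e \in G else e \in G'.
Proof. by rewrite !inE; case: (e \in B); rewrite ?andbT ?andbF ?orbF. Qed.

Lemma mixK B G G' : mix B (mix B G G') (mix B G' G) = G.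
Proof. by apply/setP => e; rewrite !in_mix; case: ifP => ->. Qed.

Lemma weight_mix B G G' :
  weight (mix B G G') * weight (mix B G' G) = weight G * weight G'.
Proof.
rewrite /weight -!big_split /=; apply: eq_bigr => e _; rewrite !in_mix.
by case: (e \in B); rewrite // mulrC.
Qed.

(** Two independent copies of the random set may exchange their traces on [B]
    without changing their joint law; independence and positive correlation
    below are both consequences of this symmetry. *)
Lemma sum_mix B (F : {set T} -> {set T} -> R) :
  \sum_(G : {set T}) \sum_(G' : {set T}) weight G * weight G' * F G G' =
  \sum_(G : {set T}) \sum_(G' : {set T})
     weight G * weight G' * F (mix B G G') (mix B G' G).
Proof.
rewrite !pair_bigA /=.
pose h (z : {set T} * {set T}) := (mix B z.1 z.2, mix B z.2 z.1).
have hK : involutive h by move=> [G G']; rewrite /h /= !mixK.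
rewrite (reindex_inj (inv_inj hK)) /=.
apply: eq_bigr => -[G G0] _ /=. by rewrite weight_mix.
Qed.

Lemma expectM2 f g :
  expect f * expect g = \sum_(G : {set T}) \sum_(G' : {set T})
    weight G * weight G' * (f G * g G').
Proof.
rewrite /expect big_distrlr; apply: eq_bigr => G _; apply: eq_bigr => G' _.
by rewrite mulrACA.
Qed.

(** After the traces on the complement of [B] are made to come from the second
    copy, [f] sees only the first copy and [g] only the second. *)
Lemma expect_indep B f g :
    (forall G, f (G :&: B) = f G) -> (forall G, g (G :\: B) = g G) ->
  expect (fun G => f G * g G) = expect f * expect g.
Proof.
move=> fB gB; rewrite -[LHS]mulr1 -expect1 !expectM2 (sum_mix B).
apply: eq_bigr => G _; apply: eq_bigr => G' _; rewrite mulr1; congr (_ * _).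
rewrite -(fB (mix _ _ _)) -(gB (mix _ _ _)) -(fB G) -(gB G').
congr (f _ * g _); apply/setP => e; rewrite !inE.
  by case: (e \in B); rewrite ?andbT ?andbF ?orbF.
by case: (e \in B); rewrite ?andbT ?andbF ?orbF.
Qed.

Hypothesis q01 : forall e, 0 <= q e <= 1.

Lemma weight_ge0 G : 0 <= weight G.
Proof.
apply: prodr_ge0 => e _; have /andP[q0 q1] := q01 e.
by case: ifP; rewrite ?subr_ge0.
Qed.

Lemma expect_le f g : (forall G, f G <= g G) -> expect f <= expect g.
Proof. by move=> fg; apply: ler_sum => G _; rewrite ler_wpM2l ?weight_ge0. Qed.

Lemma expect_ge0 f : (forall G, 0 <= f G) -> 0 <= expect f.
Proof. by move=> f0; apply: sumr_ge0 => G _; rewrite mulr_ge0 ?weight_ge0. Qed.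

Lemma prob_ge0 A : 0 <= prob A.
Proof. by apply: expect_ge0 => G; rewrite ler0n. Qed.

Lemma prob_le (A A' : pred {set T}) : subpred A A' -> prob A <= prob A'.
Proof.
by move=> AA'; apply: expect_le => G; rewrite ler_nat; have := AA' G;
  case: (A G) => // ->.
Qed.

Lemma prob_le1 A : prob A <= 1.
Proof. by rewrite -expect1; apply: expect_le => G; rewrite lern1 leq_b1. Qed.

Lemma probC A : prob (fun G => ~~ A G) = 1 - prob A.
Proof.
apply/eqP; rewrite eq_sym subr_eq -expect1 -expectD; apply/eqP.
by apply: eq_expect => G; case: (A G); rewrite ?addr0 ?add0r.
Qed.

Definition nonincreasing_on_sets f := forall G G', G \subset G' -> f G' <= f G.

(** Exchanging the coordinate [e] between the two copies turns the sum of
    [f G * D] into that of [- f (G with e exchanged) * D], where [D] is the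
    increment of [g] along the step; in the average of both, the two increments
    have the same sign. *)
Lemma correlation_step f g e B : e \notin B ->
    nonincreasing_on_sets f -> nonincreasing_on_sets g ->
  \sum_(G : {set T}) \sum_(G' : {set T})
     weight G * weight G' * (f G * g (mix B G G')) <=
  \sum_(G : {set T}) \sum_(G' : {set T})
     weight G * weight G' * (f G * g (mix (e |: B) G G')).
Proof.
move=> eB fmono gmono; rewrite -subr_ge0 -sumrB.
pose D G G' := g (mix (e |: B) G G') - g (mix B G G').
have ->: \sum_G (\sum_G' weight G * weight G' * (f G * g (mix (e |: B) G G')) -
      \sum_G' weight G * weight G' * (f G * g (mix B G G'))) =
    \sum_G \sum_G' weight G * weight G' * (f G * D G G').
  apply: eq_bigr => G _; rewrite -sumrB; apply: eq_bigr => G' _.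
  by rewrite -!mulrBr.
set S := (X in 0 <= X).
pose E := ~: [set e].
have swapD G G' : D (mix E G G') (mix E G' G) = - D G G'.
  rewrite /D opprB; congr (g _ - g _); apply/setP => x; rewrite !in_mix !inE.
    by have [->|] := eqVneq x e; rewrite ?(negPf eB) //=; case: (x \in B).
  by have [->|] := eqVneq x e; rewrite ?(negPf eB) //=; case: (x \in B).
have S2 : S + S = \sum_(G : {set T}) \sum_(G' : {set T})
    weight G * weight G' * ((f G - f (mix E G G')) * D G G').
  rewrite {2}[S](sum_mix E (fun G G' => f G * D G G')) -big_split.
  apply: eq_bigr => G _.
  by rewrite -big_split; apply: eq_bigr => G' _;
    rewrite /= swapD mulrBl mulrN -mulrDr.
rewrite -(pmulrn_lge0 S (isT : 0 < 2)%N) mulr2n S2.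
apply: sumr_ge0 => G _; apply: sumr_ge0 => G' _.
apply: mulr_ge0; first by rewrite mulr_ge0 ?weight_ge0.
case eG: (e \in G); case eG': (e \in G').
- rewrite /D (_ : mix (e |: B) G G' = mix B G G') ?subrr ?mulr0 //.
  apply/setP => x; rewrite !in_mix !inE.
  by have [->|//] := eqVneq x e; rewrite (negPf eB) eG eG'.
- apply: mulr_le0; rewrite /D subr_le0.
    apply: fmono; apply/subsetP => x; rewrite in_mix !inE.
    by have [->|//] := eqVneq x e; rewrite /= eG'.
  apply: gmono; apply/subsetP => x; rewrite !in_mix !inE.
  by have [->|//] := eqVneq x e; rewrite (negPf eB) eG'.
- apply: mulr_ge0; rewrite /D subr_ge0.
    apply: fmono; apply/subsetP => x; rewrite in_mix !inE.
    by have [->|//] := eqVneq x e; rewrite /= eG.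
  apply: gmono; apply/subsetP => x; rewrite !in_mix !inE.
  by have [->|//] := eqVneq x e; rewrite (negPf eB) eG.
- rewrite /D (_ : mix (e |: B) G G' = mix B G G') ?subrr ?mulr0 //.
  apply/setP => x; rewrite !in_mix !inE.
  by have [->|//] := eqVneq x e; rewrite (negPf eB) eG eG'.
Qed.

(** Harris' inequality: the correlation sum grows as the second copy is
    replaced, one coordinate at a time, by the first. *)
Lemma harris f g :
    nonincreasing_on_sets f -> nonincreasing_on_sets g ->
  expect f * expect g <= expect (fun G => f G * g G).
Proof.
move=> fmono gmono.
pose phi B := \sum_(G : {set T}) \sum_(G' : {set T})
     weight G * weight G' * (f G * g (mix B G G')).
have phiU (s : seq T) : phi set0 <= phi [set x in s].
  elim: s => [|e s IHs]; first by rewrite set_nil.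
  apply: le_trans IHs _; rewrite set_cons.
  have [es|es] := boolP (e \in [set x in s]); last exact: correlation_step.
  by rewrite (setUidPr _) ?sub1set.
have phi0 : phi set0 = expect f * expect g.
  rewrite expectM2; apply: eq_bigr => G _; apply: eq_bigr => G' _.
  by rewrite /mix setI0 setD0 set0U.
have phiT : phi [set x in enum T] = expect (fun G => f G * g G).
  rewrite -[RHS]mulr1 -expect1 expectM2.
  apply: eq_bigr => G _; apply: eq_bigr => G' _; rewrite mulr1.
  congr (_ * (_ * g _)); apply/setP => x.
  by rewrite in_mix inE mem_enum.
by rewrite -phi0 -phiT.
Qed.

Implicit Types (F : {set {set T}}).

Definition avoids F G : bool := [forall S in F, ~~ (S \subset G)].
Definition isolated C F G : bool := (C \subset G) && avoids F G.

Lemma avoidsU F F' G : avoids (F :|: F') G = avoids F G && avoids F' G.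
Proof.
apply/forall_inP/andP => [FG|[/forall_inP FG /forall_inP FG'] S].
  by split; apply/forall_inP => S SF; apply: FG; rewrite inE SF ?orbT.
by rewrite inE => /orP[/FG|/FG'].
Qed.

Lemma avoids_sub F F' G : F \subset F' -> avoids F' G -> avoids F G.
Proof.
by move=> /subsetP sFF' /forall_inP aF'; apply/forall_inP => S /sFF' /aF'.
Qed.

Lemma avoids_nonincreasing F : nonincreasing_on_sets (fun G => (avoids F G)%:R).
Proof.
move=> G G' sGG'; rewrite ler_nat.
case aF': (avoids F G') => //; rewrite lt0b; apply/forall_inP => S SF.
by apply: contra (forall_inP aF' S SF) => /subset_trans; apply.
Qed.

Lemma prob_avoidsU F F' :
  prob (avoids F) * prob (avoids F') <= prob (avoids (F :|: F')).
Proof.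
apply: le_trans (harris (@avoids_nonincreasing F) (@avoids_nonincreasing F')) _.
by apply: expect_le => G; rewrite avoidsU -mulnb natrM.
Qed.

Lemma prob_avoids0 : prob (avoids set0) = 1.
Proof.
rewrite -expect1; apply: eq_expect => G.
by rewrite (_ : avoids set0 G) //; apply/forall_inP => S; rewrite inE.
Qed.

Lemma prob_avoids1 S : prob (avoids [set S]) = 1 - \prod_(e in S) q e.
Proof.
rewrite -prob_supset -probC; apply: eq_expect => G; congr (_ %:R).
congr nat_of_bool; apply/forall_inP/idP => [|SG S']; first by apply; rewrite inE.
by rewrite inE => /eqP->.
Qed.

(** Avoiding each member of [F] is a decreasing event, so Harris' inequality
    applies member by member, even though the members may overlap. *)
Lemma prob_avoids_ge_prod F :
  \prod_(S in F) (1 - \prod_(e in S) q e) <= prob (avoids F).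
Proof.
rewrite -big_enum -{2}[F]set_enum /=; elim: (enum F) => [|S s IHs].
  by rewrite big_nil set_nil prob_avoids0.
rewrite big_cons set_cons; apply: le_trans (prob_avoidsU _ _).
by rewrite prob_avoids1 ler_wpM2l // subr_ge0 -prob_supset prob_le1.
Qed.

Lemma prob_avoids_ge_sum F :
  1 - \sum_(S in F) \prod_(e in S) q e <= prob (avoids F).
Proof.
have -> : prob (avoids F) = 1 - prob (fun G => ~~ avoids F G).
  by rewrite -probC; apply: eq_expect => G; rewrite negbK.
rewrite lerD2l lerN2; under eq_bigr do rewrite -prob_supset.
rewrite /prob -expect_sum; apply: expect_le => G.
rewrite -natr_sum ler_nat; case aF: (avoids F G) => //=.
move/negbT: aF; rewrite negb_forall_in => /exists_inP[S SF].
by rewrite negbK => SG; rewrite (bigD1 S) //= SG.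
Qed.

Lemma avoids_setI B F G :
  (forall S, S \in F -> S \subset B) -> avoids F (G :&: B) = avoids F G.
Proof.
move=> FB; apply: eq_forallb_in => S SF; congr (~~ _).
by rewrite subsetI (FB S SF) andbT.
Qed.

Lemma isolated_setI B C F G : C \subset B ->
  (forall S, S \in F -> S \subset B) -> isolated C F (G :&: B) = isolated C F G.
Proof. by move=> CB FB; rewrite /isolated subsetI CB andbT avoids_setI. Qed.

(** The presence of [C] and the avoidance of [F] look at disjoint coordinates. *)
Lemma prob_isolated B C F : C \subset B ->
    (forall S, S \in F -> S \subset ~: B) ->
  prob (isolated C F) = (\prod_(e in C) q e) * prob (avoids F).
Proof.
move=> CB FB; rewrite -prob_supset /prob -(@expect_indep B).
- by apply: eq_expect => G; rewrite /isolated -mulnb natrM.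
- by move=> G; rewrite subsetI CB andbT.
- by move=> G; rewrite setDE avoids_setI.
Qed.

Lemma prob_isolated_indep B C F C' F' :
    C \subset B -> (forall S, S \in F -> S \subset B) ->
    C' \subset ~: B -> (forall S, S \in F' -> S \subset ~: B) ->
  prob (fun G => isolated C F G && isolated C' F' G) =
    prob (isolated C F) * prob (isolated C' F').
Proof.
move=> CB FB C'B F'B; rewrite /prob -(@expect_indep B).
- by apply: eq_expect => G; rewrite -mulnb natrM.
- by move=> G; rewrite isolated_setI.
- by move=> G; rewrite setDE isolated_setI.
Qed.

(** Chebyshev's inequality at 0 for the number [X] of events that occur: where
    none occurs, [(X - mu)^2] equals [mu^2]. *)
Lemma second_moment (I : finType) (A : I -> pred {set T}) :
  prob (fun G => ~~ [exists i, A i G]) * (\sum_i prob (A i)) ^+ 2 <=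
  \sum_i \sum_j prob (fun G => A i G && A j G) - (\sum_i prob (A i)) ^+ 2.
Proof.
set mu := \sum_i prob (A i).
pose X G : R := \sum_i (A i G)%:R.
have EX : expect X = mu by rewrite expect_sum.
have EX2 : expect (fun G => X G ^+ 2) =
    \sum_i \sum_j prob (fun G => A i G && A j G).
  under eq_bigr do rewrite -expect_sum.
  rewrite -expect_sum; apply: eq_expect => G; rewrite expr2 big_distrlr /=.
  by apply: eq_bigr => i _; apply: eq_bigr => j _; rewrite -natrM mulnb.
have EV : expect (fun G => (X G - mu) ^+ 2) =
    expect (fun G => X G ^+ 2) - mu ^+ 2.
  transitivity (expect (fun G => X G ^+ 2 + ((- 2 * mu) * X G + mu ^+ 2 * 1))).
    by apply: eq_expect => G; ring.
  by rewrite expectD expectD !expectZ EX expect1; ring.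
rewrite -EX2 -EV mulrC /prob -expectZ; apply: expect_le => G.
have [_|] := boolP [exists i, A i G]; first by rewrite mulr0 sqr_ge0.
rewrite negb_exists => /forallP noA; rewrite mulr1 /X big1 => [|i _].
  by rewrite sub0r sqrrN.
by rewrite (negPf (noA i)).
Qed.

End RandomSubset.

(** * Isolated copies of K4 minus an edge and maximum F5-free subhypergraphs *)

Section IsolatedK4minus.
Variable (V : finType).
Implicit Types (G H : {set {set V}}) (K : {set V}) (v w : 'I_4 -> V).

Definition closed_pairs K G := forall x y z, x \in K -> y \in K -> x != y ->
  [set x; y; z] \in G -> z \in K.

Definition disjoint_links K G := forall x y d e, x \in K -> y \in K -> x != y ->
  d \notin K -> e \notin K -> [set x; d; e] \in G -> [set y; d; e] \notin G.

(** Take the edges of [F_5] to be [abc], [ade], [bde]. If [ade] lies in [K], the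
    pair [de] forces [b] into [K], then [ab] forces [c]; likewise for [bde]. If
    [abc] lies in [K], then either [d] or [e] is in [K], and the other follows
    from [ade], or both are outside and [de] is in the links of both [a] and
    [b]. Apart from this last contradiction, [K] receives five vertices. *)
Lemma no_F5_edge_inside K G (f : 'I_5 -> V) (E : {set 'I_5}) :
    (#|K| <= 4)%N -> closed_pairs K G -> disjoint_links K G -> injective f ->
    (forall E', E' \in F5 -> f @: E' \in G) -> E \in F5 ->
  ~~ (f @: E \subset K).
Proof.
move=> K4 cK dK finj fG EF; apply/negP => EK.
pose a := f (inord 0); pose b := f (inord 1); pose c := f (inord 2).
pose d := f (inord 3); pose e := f (inord 4).
have img x y z : f @: [set x; y; z] = [set f x; f y; f z].
  by rewrite !imsetU !imset_set1.
have abc : [set a; b; c] \in G by rewrite -img fG // /F5 !inE eqxx.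
have ade : [set a; d; e] \in G by rewrite -img fG // /F5 !inE eqxx orbT.
have bde : [set b; d; e] \in G by rewrite -img fG // /F5 !inE eqxx !orbT.
have neq i j : (i < 5)%N -> (j < 5)%N -> i != j ->
    f (inord i) != f (inord j) :> V.
  move=> i5 j5; apply: contra => /eqP /finj /(congr1 val) /=.
  by rewrite !inordK // => ->.
have not5 : ~ [/\ a \in K, b \in K, c \in K, d \in K & e \in K].
  case=> aK bK cK1 dK1 eK1; suff: (5 <= #|K|)%N by rewrite leqNgt ltnS K4.
  rewrite -[5%N]card_ord -cardsT -(card_imset _ finj) subset_leq_card //.
  apply/subsetP => _ /imsetP[i _ ->].
  have -> : i = inord i by apply: val_inj; rewrite /= inordK.
  by case: i => [[|[|[|[|[|]]]]]].
have in3 x y z : f @: [set x; y; z] \subset K ->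
    [/\ f x \in K, f y \in K & f z \in K].
  by rewrite img !subUset !sub1set => /andP[/andP[-> ->] ->].
have rot3 x y z : [set x; y; z] = [set y; z; x] :> {set V}.
  by rewrite -setUA setUC.
have swap3 x y z : [set x; y; z] = [set x; z; y] :> {set V}.
  by rewrite -!setUA [[set y; z]]setUC.
have ab : a != b by exact: neq.
move: EF EK; rewrite /F5 !inE => /orP[/orP[]|] /eqP-> /in3[].
- rewrite -/a -/b -/c => aK bK cK1.
  have [dK1|dK1] := boolP (d \in K).
    by apply: not5; split=> //; apply: cK aK dK1 _ ade; apply: neq.
  have [eK1|eK1] := boolP (e \in K).
    case/negP: dK1; apply: cK aK eK1 _ _; first exact: neq.
    by rewrite swap3.
  by have := dK _ _ _ _ aK bK ab dK1 eK1 ade; rewrite bde.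
- rewrite -/a -/d -/e => aK dK1 eK1.
  have bK : b \in K by apply: cK dK1 eK1 _ _; [exact: neq|rewrite -rot3].
  by apply: not5; split=> //; apply: cK aK bK ab abc.
- rewrite -/b -/d -/e => bK dK1 eK1.
  have aK : a \in K by apply: cK dK1 eK1 _ _; [exact: neq|rewrite -rot3].
  by apply: not5; split=> //; apply: cK aK bK ab abc.
Qed.

(** Otherwise the edge could be added to [H] without creating an [F_5]. *)
Lemma isolated_edge_in_maximum K G H e :
    (#|K| <= 4)%N -> closed_pairs K G -> disjoint_links K G ->
    maximum_F5_free G H -> e \in G -> e \subset K ->
  e \in H.
Proof.
move=> K4 cK dK /and3P[HG Hfree /forallP Hmax] eG eK.
apply: contraT => eH; have := Hmax (e |: H).
rewrite cardsU1 eH ltnn implybF negb_and subUset sub1set eG HG /= negbK.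
case/existsP=> f /andP[/injectiveP finj /forall_inP fH].
have fG E' : E' \in F5 -> f @: E' \in G.
  by move=> /fH; rewrite in_setU1 => /predU1P[->//|]; apply: (subsetP HG).
case/negP: Hfree; apply/existsP; exists f; apply/andP; split.
  exact/injectiveP.
apply/forall_inP => E' E'F; have := fH _ E'F.
rewrite in_setU1 => /predU1P[fE|//].
by have := no_F5_edge_inside K4 cK dK finj fG E'F; rewrite fE eK.
Qed.

Lemma exists_maximum_F5_free G : exists H, maximum_F5_free G H.
Proof.
pose P H := (H \subset G) && F5_free H.
have P0 : P set0.
  rewrite /P sub0set; apply/existsP => -[f /andP[_ /forall_inP fE]].
  by have := fE [set inord 0; inord 1; inord 2]; rewrite !inE eqxx => /(_ isT).
case: (arg_maxnP (fun H : {set {set V}} => #|H|) P0) => H /andP[HG Hfree] Hmax.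
exists H; rewrite /maximum_F5_free HG Hfree /=; apply/forallP => H'.
by apply/implyP => /Hmax.
Qed.

(** The [K_4^-] with apex [v ord0]: on the four vertices of [v], all triples
    but the one avoiding the apex, each triple being indexed by the vertex that
    it misses. *)
Definition K4minus v : {set {set V}} := [set v @: [set~ i] | i in [set~ ord0]].

Definition span v : {set V} := v @: setT.

Lemma span_card v : (#|span v| <= 4)%N.
Proof. by rewrite (leq_trans (leq_imset_card _ _)) // cardsT card_ord. Qed.

Lemma mem_span v i : v i \in span v.
Proof. exact: imset_f. Qed.

Lemma K4minus_span v e : e \in K4minus v -> e \subset span v.
Proof. by case/imsetP=> i _ ->; rewrite imsetS ?subsetT. Qed.

Lemma K4minus_card v e : injective v -> e \in K4minus v -> #|e| = 3%N.
Proof.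
by move=> vinj /imsetP[i _ ->]; rewrite card_imset // cardsC1 card_ord.
Qed.

Lemma card_K4minus v : injective v -> #|K4minus v| = 3%N.
Proof.
move=> vinj; rewrite card_imset ?cardsC1 ?card_ord // => i j eij.
apply/eqP; have := mem_imset [set~ i] i vinj.
by rewrite eij mem_imset // !inE eqxx => /negbFE.
Qed.

Lemma K4minus_cover_pair v i j : injective v -> i != j ->
  exists2 e, e \in K4minus v & (v i \in e) && (v j \in e).
Proof.
move=> vinj ij; have /set0Pn[k] : ~: [set ord0; i; j] != set0.
  rewrite -card_gt0 cardsCs setCK card_ord subn_gt0 ltnS.
  rewrite !(leq_trans (leq_card_setU _ _)) // !cards1.
  by rewrite (cards2 ord0 i); case: eqP.
rewrite !inE !negb_or => /andP[/andP[k0 ki] kj].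
exists (v @: [set~ k]); first by rewrite imset_f // !inE.
by rewrite !mem_imset // !inE ![_ == k]eq_sym ki kj.
Qed.

Lemma K4minus_triple v i j k : i != j -> i != k -> j != k ->
  ord0 \in [set i; j; k] -> [set v i; v j; v k] \in K4minus v.
Proof.
move=> ij ik jk in0; have /cards1P[t tE] : #|~: [set i; j; k]| == 1%N.
  rewrite cardsCs setCK card_ord setUC cardsU1 cards2 !inE negb_or ij.
  by rewrite ![k == _]eq_sym ik jk.
apply/imsetP; exists t.
  by rewrite !inE; apply: contraL in0 => /eqP <-; rewrite -in_setC tE set11.
by rewrite -tE setCK !imsetU !imset_set1.
Qed.

Lemma K4minus_not_tripartite v H :
  injective v -> K4minus v \subset H -> ~~ tripartite H.
Proof.
move=> vinj vH; apply/existsP => -[c /forall_inP cH].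
suff cinj : injective (c \o v).
  by have := leq_card _ cinj; rewrite !card_ord.
move=> i j /= cij; apply/eqP; apply: contraT => ij.
have [e ev /andP[ie je]] := K4minus_cover_pair vinj ij.
have /forallP/(_ (c (v i)))/cards1P[x ex] := cH _ (subsetP vH _ ev).
have: v i \in [set x] by rewrite -ex inE ie eqxx.
have: v j \in [set x] by rewrite -ex inE je cij eqxx.
by rewrite !inE => /eqP <- /eqP /vinj /eqP; rewrite (negPf ij).
Qed.

(** The two ways in which isolation fails, as edge sets that [G] may not
    contain: a single edge sticking out of the span by one vertex, and two edges
    whose outer pairs coincide. *)
Definition pendant v (t : 'I_4 * 'I_4 * V) : {set {set V}} :=
  [set [set v t.1.1; v t.1.2; t.2]].

Definition cherry v (t : 'I_4 * 'I_4 * V * V) : {set {set V}} :=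
  [set [set v t.1.1.1; t.1.2; t.2]; [set v t.1.1.2; t.1.2; t.2]].

Definition pendants v : {set {set {set V}}} :=
  [set pendant v t | t in [pred t | (t.1.1 != t.1.2) && (t.2 \notin span v)]].

Definition cherries v : {set {set {set V}}} :=
  [set cherry v t | t in [pred t : 'I_4 * 'I_4 * V * V |
     [&& t.1.1.1 != t.1.1.2, t.1.2 \notin span v & t.2 \notin span v]]].

Definition threats v := pendants v :|: cherries v.

Variant threat_spec v : {set {set V}} -> Prop :=
| Pendant i j z of i != j & z \notin span v :
    threat_spec v [set [set v i; v j; z]]
| Cherry i j d e of i != j & d \notin span v & e \notin span v :
    threat_spec v [set [set v i; d; e]; [set v j; d; e]].

Lemma threatP v S : reflect (threat_spec v S) (S \in threats v).
Proof.
apply: (iffP setUP) => [[]|].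
- by case/imsetP=> -[[i j] z] /= /andP[ij zv] ->; apply: Pendant.
- by case/imsetP=> -[[[i j] d] e] /= /and3P[ij dv ev] ->; apply: Cherry.
case=> [i j z ij zv|i j d e ij dv ev].
  by left; apply/imsetP; exists (i, j, z); rewrite // inE /= ij.
by right; apply/imsetP; exists (i, j, d, e); rewrite // inE /= ij dv.
Qed.

Definition isolated_K4minus v G := isolated (K4minus v) (threats v) G.

Lemma isolated_closed_pairs v G :
  isolated_K4minus v G -> closed_pairs (span v) G.
Proof.
case/andP=> _ /forall_inP av _ _ z /imsetP[i _ ->] /imsetP[j _ ->] vij ijz.
apply: contraT => zv; have ij : i != j by apply: contra vij => /eqP->.
by have := av _ (introT (threatP _ _) (Pendant ij zv)); rewrite sub1set ijz.
Qed.

Lemma isolated_disjoint_links v G :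
  isolated_K4minus v G -> disjoint_links (span v) G.
Proof.
case/andP=> _ /forall_inP av _ _ d e /imsetP[i _ ->] /imsetP[j _ ->].
move=> vij dv ev ide.
have ij : i != j by apply: contra vij => /eqP->.
have := av _ (introT (threatP _ _) (Cherry ij dv ev)).
by rewrite subUset !sub1set ide.
Qed.

Lemma isolated_K4minus_nontripartite v G : injective v ->
  isolated_K4minus v G ->
  [exists H : {set {set V}}, maximum_F5_free G H && ~~ tripartite H].
Proof.
move=> vinj iv; have [H Hmax] := exists_maximum_F5_free G.
apply/existsP; exists H; rewrite Hmax (K4minus_not_tripartite vinj) //.
apply/subsetP => e ev; apply: isolated_edge_in_maximum Hmax _ _.
- exact: span_card v.
- exact: isolated_closed_pairs.
- exact: isolated_disjoint_links.
- by case/andP: iv => /subsetP /(_ _ ev).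
- exact: K4minus_span.
Qed.

End IsolatedK4minus.

(** * Probability that a given copy is isolated *)

Section Threats.
Variables (R : realFieldType) (V : finType) (p : R).
Hypothesis p01 : 0 <= p <= 1.
Implicit Types (S G C : {set {set V}}) (F : {set {set {set V}}}).
Implicit Types (v w : 'I_4 -> V).

(** Only triples can be edges, so the uniform random hypergraph becomes a random
    set of arbitrary vertex subsets, in which non-triples have probability 0. *)
Definition edge_prob (e : {set V}) : R := if #|e| == 3%N then p else 0.

Let p0 : 0 <= p. Proof. by case/andP: p01. Qed.
Let p1 : p <= 1. Proof. by case/andP: p01. Qed.

Lemma edge_prob01 e : 0 <= edge_prob e <= 1.
Proof. by rewrite /edge_prob; case: ifP; rewrite ?lexx ?ler01. Qed.

Local Notation Pr := (prob edge_prob).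
Local Notation N := #|V|.

Lemma prod_edge_prob_le S : \prod_(e in S) edge_prob e <= p ^+ #|S|.
Proof.
rewrite -prodr_const; apply: ler_prod => e _; rewrite /edge_prob.
by case: ifP; rewrite p0 ?lexx.
Qed.

Lemma prod_edge_prob_K4minus v : injective v ->
  \prod_(e in K4minus v) edge_prob e = p ^+ 3.
Proof.
move=> vinj; rewrite -(card_K4minus vinj) -prodr_const.
by apply: eq_bigr => e ev; rewrite /edge_prob (K4minus_card vinj ev) eqxx.
Qed.

Lemma prob_avoids_ge_exp F (a : R) (k : nat) :
    0 <= a <= 1 -> (forall S, S \in F -> \prod_(e in S) edge_prob e <= a) ->
  (#|F| <= k)%N -> (1 - a) ^+ k <= Pr (avoids F).
Proof.
move=> /andP[a0 a1] Fa Fk; apply: le_trans (prob_avoids_ge_prod edge_prob01 F).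
apply: (@le_trans _ _ ((1 - a) ^+ #|F|)).
  by apply: ler_wiXn2l; rewrite ?subr_ge0 // lerBlDr lerDl.
rewrite -prodr_const; apply: ler_prod => S SF.
by rewrite subr_ge0 a1 lerD2l lerN2 Fa.
Qed.

Lemma prob_avoids_ge_card F (a : R) (k : nat) : 0 <= a ->
    (forall S, S \in F -> \prod_(e in S) edge_prob e <= a) ->
  (#|F| <= k)%N -> 1 - k%:R * a <= Pr (avoids F).
Proof.
move=> a0 Fa Fk; apply: le_trans (prob_avoids_ge_sum edge_prob01 F).
rewrite lerD2l lerN2; apply: (@le_trans _ _ (\sum_(S in F) a)).
  exact: ler_sum.
by rewrite sumr_const -[a *+ _]mulr_natl ler_wpM2r // ler_nat.
Qed.

Lemma pendants_prob_le v S : S \in pendants v ->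
  \prod_(e in S) edge_prob e <= p.
Proof.
by case/imsetP=> t _ ->; rewrite (le_trans (prod_edge_prob_le _)) // cards1.
Qed.

Lemma cherries_prob_le v S : injective v -> S \in cherries v ->
  \prod_(e in S) edge_prob e <= p ^+ 2.
Proof.
move=> vinj /imsetP[[[[i j] d] e]] /and3P[/= ij dv ev] ->.
rewrite (le_trans (prod_edge_prob_le _)) // cards2.
suff -> : [set v i; d; e] != [set v j; d; e] by [].
apply/eqP => /setP /(_ (v i)); rewrite !inE eqxx /=.
rewrite (inj_eq vinj) (negPf ij) /= => /esym /orP[]/eqP vE.
  by rewrite -vE mem_span in dv.
by rewrite -vE mem_span in ev.
Qed.

Lemma threats_not_inside v S :
  S \in threats v -> S \subset ~: powerset (span v).
Proof.
case/threatP=> [i j z ij zv|i j d e ij dv ev].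
  by rewrite sub1set !inE !subUset !sub1set (negPf zv) andbF.
by rewrite !subUset !sub1set !inE !subUset !sub1set (negPf ev) !andbF.
Qed.

Lemma prob_isolated_K4minus v F : injective v -> F \subset threats v ->
  Pr (isolated (K4minus v) F) = p ^+ 3 * Pr (avoids F).
Proof.
move=> vinj Fv; rewrite -(prod_edge_prob_K4minus vinj).
apply: (@prob_isolated _ _ _ (powerset (span v))).
  by apply/subsetP => e /K4minus_span; rewrite inE.
by move=> S /(subsetP Fv) /threats_not_inside.
Qed.

(** Two positions in the copy and one outer vertex determine a pendant, two
    positions and two outer vertices a cherry, whence the exponents. *)
Lemma prob_isolated_K4minus_ge v : injective v ->
  p ^+ 3 * ((1 - p) ^+ (16 * N) * (1 - p ^+ 2) ^+ (16 * N ^ 2))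
    <= Pr (isolated_K4minus v).
Proof.
move=> vinj; rewrite prob_isolated_K4minus ?subxx // ler_wpM2l ?exprn_ge0 //.
apply: le_trans (prob_avoidsU edge_prob01 _ _).
apply: ler_pM; rewrite ?exprn_ge0 ?subr_ge0 ?exprn_ile1 //.
- apply: prob_avoids_ge_exp => //; first exact: pendants_prob_le.
  rewrite (leq_trans (leq_imset_card _ _)) // (leq_trans (max_card _)) //.
  by rewrite !card_prod !card_ord.
- apply: prob_avoids_ge_exp; first by rewrite exprn_ge0 ?exprn_ile1.
    by move=> S; apply: cherries_prob_le.
  rewrite (leq_trans (leq_imset_card _ _)) // (leq_trans (max_card _)) //.
  by rewrite !card_prod !card_ord mulnA.
Qed.

Definition touching w : {set {set V}} :=
  [set e : {set V} | ~~ [disjoint e & span w]].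

(** The threats to [v] that can be tested without looking at edges touching
    [w]. *)
Definition threats_off v w : {set {set {set V}}} :=
  [set S in threats v | S \subset ~: touching w].

Lemma threats_off_sub v w : threats_off v w \subset threats v.
Proof. by apply/subsetP => S; rewrite inE => /andP[]. Qed.

Lemma triple_disjoint (x y z : V) (B : {set V}) :
  [disjoint [set x; y; z] & B] = [&& x \notin B, y \notin B & z \notin B].
Proof. by rewrite disjoints_subset !subUset !sub1set !inE andbA. Qed.

Lemma mem_touching v i (e : {set V}) : v i \in e -> e \in touching v.
Proof.
move=> ie; rewrite inE; apply/pred0Pn; exists (v i).
by rewrite /= ie mem_span.
Qed.

Lemma K4minus_touching v : injective v -> K4minus v \subset touching v.
Proof.
move=> vinj; apply/subsetP => e /[dup] /(K4minus_card vinj) e3 /K4minus_span ev.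
rewrite inE -setI_eq0 (setIidPl ev) -cards_eq0 e3 //.
Qed.

Lemma threats_touching v S : S \in threats v -> S \subset touching v.
Proof.
case/threatP=> [i j z _ _|i j d e _ _ _]; rewrite ?subUset ?sub1set.
  by rewrite (@mem_touching _ i) // !inE eqxx.
by rewrite (@mem_touching _ i) ?(@mem_touching _ j) // !inE eqxx.
Qed.

(** Keeping only the threats away from the other copy makes the two events depend
    on disjoint sets of edges: those touching [v] and those not touching it. *)
Lemma prob_two_isolated_le v w : injective v -> injective w ->
    [disjoint span v & span w] ->
  Pr (fun G => isolated_K4minus v G && isolated_K4minus w G) <=
  Pr (isolated (K4minus v) (threats_off v w)) *
  Pr (isolated (K4minus w) (threats_off w v)).
Proof.
move=> vinj winj vw; rewrite -(@prob_isolated_indep _ _ _ (touching v)).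
- apply: prob_le; first exact: edge_prob01.
  move=> G /andP[/andP[vG av] /andP[wG aw]]; apply/andP; split.
    by rewrite /isolated vG (avoids_sub _ av) // threats_off_sub.
  by rewrite /isolated wG (avoids_sub _ aw) // threats_off_sub.
- exact: K4minus_touching.
- by move=> S /(subsetP (threats_off_sub _ _)) /threats_touching.
- apply/subsetP => e /K4minus_span ew; rewrite !inE negbK.
  by rewrite disjoint_sym (disjointWr ew vw).
- by move=> S; rewrite inE => /andP[].
Qed.

(** Little is lost by forgetting the threats that touch the other span: such a
    threat is a pendant whose outer vertex is one of four, or a cherry with one
    of its outer vertices among these four. There are at most [4^3] of the former
    and [4^3 N] of the latter, and by Harris' inequality avoiding them as well
    costs at most a factor close to 1. *)
Lemma prob_threats_near v w : injective v -> [disjoint span v & span w] ->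
  64%:R * p + 64%:R * N%:R * p ^+ 2 <= 1 ->
  (1 - (64%:R * p + 64%:R * N%:R * p ^+ 2)) *
    Pr (isolated (K4minus v) (threats_off v w)) <= Pr (isolated_K4minus v).
Proof.
move=> vinj vw eps1.
pose near1 := pendants v :&:
  [set pendant v (t.1, w t.2) | t : 'I_4 * 'I_4 * 'I_4].
pose near2 := cherries v :&:
  [set cherry v (t.1, w t.2.1, t.2.2) | t : 'I_4 * 'I_4 * ('I_4 * V)].
have offw i : v i \notin span w by rewrite (disjointFr vw) ?mem_span.
have sub : threats v \subset threats_off v w :|: (near1 :|: near2).
  apply/subsetP => S Sv; rewrite inE -implyNb; apply/implyP.
  rewrite inE Sv /=; case/threatP: (Sv) => [i j z ij zv|i j d e ij dv ev].
    rewrite sub1set !inE triple_disjoint !offw /= !negbK => /imsetP[k _ zE].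
    apply/orP; left; apply/andP; split.
      by apply/imsetP; exists (i, j, z); rewrite // inE /= ij.
    by apply/imsetP; exists (i, j, k); rewrite // /pendant /= -zE.
  rewrite subUset !sub1set !inE !triple_disjoint !offw /= !negbK andbb.
  rewrite negb_and !negbK => dew; apply/orP; right; apply/andP; split.
    by apply/imsetP; exists (i, j, d, e); rewrite // inE /= ij dv.
  case/orP: dew => /imsetP[k _ kE].
    by apply/imsetP; exists (i, j, (k, e)); rewrite // /cherry /= -kE.
  (* a cherry is symmetric in its two outer vertices *)
  apply/imsetP; exists (i, j, (k, d)); rewrite // /cherry /= -kE.
  by rewrite -!setUA [[set e; d]]setUC.
rewrite !prob_isolated_K4minus ?threats_off_sub // mulrCA.
rewrite ler_wpM2l ?exprn_ge0 //.
apply: (@le_trans _ _ (Pr (avoids (threats_off v w :|: (near1 :|: near2)))));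
  last first.
  by apply: prob_le; [exact: edge_prob01|move=> G; apply: avoids_sub].
apply: le_trans (prob_avoidsU edge_prob01 _ _); rewrite mulrC ler_wpM2l //.
  exact: prob_ge0 edge_prob01 _.
apply: le_trans (prob_avoidsU edge_prob01 _ _).
have n1 : 1 - 64%:R * p <= Pr (avoids near1).
  apply: prob_avoids_ge_card => // [S|]; first by case/setIP=> /pendants_prob_le.
  rewrite (leq_trans (subset_leq_card (subsetIr _ _))) //.
  rewrite (leq_trans (leq_imset_card _ _)) // (leq_trans (max_card _)) //.
  by rewrite !card_prod !card_ord.
have n2 : 1 - 64%:R * N%:R * p ^+ 2 <= Pr (avoids near2).
  rewrite -natrM; apply: prob_avoids_ge_card; first by rewrite exprn_ge0.
    by move=> S /setIP[/(cherries_prob_le vinj)].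
  rewrite (leq_trans (subset_leq_card (subsetIr _ _))) //.
  rewrite (leq_trans (leq_imset_card _ _)) // (leq_trans (max_card _)) //.
  by rewrite !card_prod !card_ord mulnA.
set a := 64%:R * p in eps1 n1 *; set b := 64%:R * N%:R * p ^+ 2 in eps1 n2 *.
have a0 : 0 <= a by rewrite mulr_ge0.
have b0 : 0 <= b by rewrite mulr_ge0 ?exprn_ge0 // mulr_ge0.
apply: le_trans (ler_pM _ _ n1 n2); [|lra|lra].
have : 0 <= a * b by rewrite mulr_ge0.
clearbody a b; nra.
Qed.
End Threats.

(** * Second moment of the number of isolated copies *)

Section Family.
Variables (R : realFieldType) (V : finType) (p : R) (m : nat).
Variable phi : 'I_4 * 'I_m -> V.
Hypothesis p01 : 0 <= p <= 1.
Hypothesis phi_inj : injective phi.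
Implicit Types (G : {set {set V}}) (x y : {ffun 'I_4 -> 'I_m}).

Let p0 : 0 <= p. Proof. by case/andP: p01. Qed.
Local Notation Pr := (prob (edge_prob p)).
Local Notation N := #|V|.

(** The family of candidate [K_4^-]'s: one vertex in each of four disjoint
    blocks, so that two candidates meet exactly where their indices agree. *)
Definition place x (i : 'I_4) : V := phi (i, x i).

Lemma place_inj x : injective (place x).
Proof. by move=> i j /phi_inj []. Qed.

Lemma mem_span_place x y i : (place x i \in span (place y)) = (x i == y i).
Proof.
apply/imsetP/eqP => [[j _ /phi_inj[<- //]]|xy].
by exists i; rewrite // /place xy.
Qed.

Lemma span_place_disjoint x y : (forall i, x i != y i) ->
  [disjoint span (place x) & span (place y)].
Proof.
move=> xy; apply/pred0P => u /=; apply/negP => /andP[/imsetP[i _ ->]].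
by rewrite mem_span_place (negPf (xy i)).
Qed.

(** Some edge of the second copy has two vertices in common with the first copy
    and its third vertex outside it, hence is a pendant of the first copy. Such an
    edge must contain the apex position: if the copies differ there, it is
    completed by the apex; otherwise the apex is one of the common vertices. *)
Lemma isolated_exclusive x y i j k G :
    i != j -> x i = y i -> x j = y j -> x k != y k ->
  ~~ (isolated_K4minus (place x) G && isolated_K4minus (place y) G).
Proof.
move=> ij xyi xyj xyk; apply/negP => /andP[/isolated_closed_pairs cx].
case/andP=> /subsetP yG _.
have contra3 a b c : a != b -> x a = y a -> x b = y b -> x c != y c ->
    ord0 \in [set a; b; c] -> False.
  move=> ab xya xyb xyc abc.
  have ac : a != c by apply: contraNneq xyc => <-; rewrite xya.
  have bc : b != c by apply: contraNneq xyc => <-; rewrite xyb.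
  have := yG _ (K4minus_triple (place y) ab ac bc abc).
  move/cx; rewrite !mem_span_place xya xyb !eqxx => /(_ isT isT).
  rewrite (inj_eq (@place_inj y)) ab => /(_ isT) /eqP yx.
  by rewrite yx eqxx in xyc.
have [xy0|xy0] := eqVneq (x ord0) (y ord0); last first.
  by apply: (contra3 i j ord0) => //; rewrite !inE eqxx orbT.
have [i0|i0] := eqVneq i ord0.
  by apply: (contra3 i j k) => //; rewrite !inE i0 eqxx.
by apply: (contra3 ord0 i k); rewrite // 1?eq_sym // !inE eqxx.
Qed.

(** A common edge would have three vertices in common positions. *)
Lemma K4minus_place_disjoint x y :
    (forall i j, x i = y i -> x j = y j -> i = j) ->
  [disjoint K4minus (place x) & K4minus (place y)].
Proof.
move=> xy1; apply/pred0P => e /=; apply/negP => /andP[ex /K4minus_span ey].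
have eqx i : place x i \in e -> x i = y i.
  by move=> ie; apply/eqP; rewrite -mem_span_place (subsetP ey).
have /imsetP[t _ eE] := ex.
have: (2 < #|[set~ t]|)%N by rewrite cardsC1 card_ord.
case/card_gt2P=> i [j [_ [[it jt _] [ij _ _]]]].
by case/eqP: ij; apply: xy1; apply: eqx; rewrite eE; exact: imset_f.
Qed.

Local Notation A x := (isolated_K4minus (place x)).
Local Notation eps := (64%:R * p + 64%:R * N%:R * p ^+ 2).

(** The three terms dominate the cases of disjoint copies, of copies with one
    common vertex, and of equal copies; copies with two or three common vertices
    are never both isolated. The factor [1 + 6 eps] bounds [(1 - eps)^(-2)] for
    [eps <= 1/2]. *)
Lemma prob_two_places_le x y : eps <= 2%:R^-1 ->
  Pr (fun G => A x G && A y G) <=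
    (1 + 6%:R * eps) * (Pr (A x) * Pr (A y)) +
    ((\sum_i (x i == y i))%:R * p ^+ 6 + (x == y)%:R * Pr (A x)).
Proof.
move=> eps_half; have q01 (e : {set V}) := edge_prob01 p01 e.
have eps0 : 0 <= eps by rewrite addr_ge0 ?mulr_ge0 // exprn_ge0.
have P0 z : 0 <= Pr (A z) by exact: prob_ge0.
have main0 : 0 <= (1 + 6%:R * eps) * (Pr (A x) * Pr (A y)).
  by rewrite !mulr_ge0 // addr_ge0 // mulr_ge0.
have sum0 : 0 <= (\sum_i (x i == y i))%:R * p ^+ 6.
  by rewrite mulr_ge0 ?exprn_ge0.
have [xy|xNy] := eqVneq x y.
  subst y; rewrite mul1r -[X in X <= _]add0r addrA lerD //.
    exact: addr_ge0.
  by apply: prob_le => // G /andP[].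
rewrite mul0r addr0.
have [k xyk] : exists k, x k != y k.
  apply/existsP; apply: contraR xNy; rewrite negb_exists => /forallP xy.
  by apply/eqP/ffunP => k; apply/eqP/negPn.
have [/existsP[i /existsP[j /and3P[ij /eqP xyi /eqP xyj]]]|no2] :=
    boolP [exists i, exists j, [&& i != j, x i == y i & x j == y j]].
  rewrite [Pr _](_ : _ = 0) ?addr_ge0 // /prob /expect big1 // => G _.
  by rewrite (negPf (isolated_exclusive G ij xyi xyj xyk)) mulr0.
have agree1 i j : x i = y i -> x j = y j -> i = j.
  move=> xyi xyj; apply/eqP; apply: contraR no2 => ij.
  by apply/existsP; exists i; apply/existsP; exists j; rewrite ij xyi xyj !eqxx.
have [/existsP[i xyi]|no1] := boolP [exists i, x i == y i].
  apply: ler_wpDl => //; apply: (@le_trans _ _ (p ^+ 6)); last first.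
    rewrite ler_peMl ?exprn_ge0 // ler1n (bigD1 i) //= xyi //.
  apply: (@le_trans _ _
    (Pr (fun G => K4minus (place x) :|: K4minus (place y) \subset G))).
    apply: prob_le => // G /andP[/andP[xG _] /andP[yG _]].
    by rewrite subUset xG.
  rewrite prob_supset (le_trans (prod_edge_prob_le p01 _)) //.
  rewrite cardsU (disjoint_setI0 (K4minus_place_disjoint agree1)) cards0 subn0.
  by rewrite !card_K4minus //; exact: place_inj.
have xy i : x i != y i.
  by move: no1; rewrite negb_exists => /forallP.
apply: ler_wpDr => //; have dxy := span_place_disjoint xy.
have dyx : [disjoint span (place y) & span (place x)] by rewrite disjoint_sym.
have eps1 : eps <= 1 by lra.
have joint := prob_two_isolated_le p01 (@place_inj x) (@place_inj y) dxy.
have nx := prob_threats_near p01 (@place_inj x) dxy eps1.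
have ny := prob_threats_near p01 (@place_inj y) dyx eps1.
apply: le_trans joint _; move: nx ny.
set a := Pr (isolated _ (threats_off _ _)).
set b := Pr (isolated _ (threats_off _ _)).
have a0 : 0 <= a by exact: prob_ge0.
have b0 : 0 <= b by exact: prob_ge0.
set e := eps in eps_half eps0 eps1 *; set qx := Pr _; set qy := Pr _ => nx ny.
have e1 : 0 <= 1 - e by lra.
have qq : (1 - e) * a * ((1 - e) * b) <= qx * qy.
  by apply: ler_pM; rewrite ?mulr_ge0.
apply: (@le_trans _ _ ((1 + 6%:R * e) * ((1 - e) * a * ((1 - e) * b))));
  last first.
  by rewrite ler_wpM2l // addr_ge0 // mulr_ge0.
(* (1 + 6e)(1 - e)^2 - 1 = e (1 - 2e)(4 - 3e) *)
have -> : (1 + 6%:R * e) * ((1 - e) * a * ((1 - e) * b)) =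
    a * b + a * b * (e * ((1 - 2%:R * e) * (4%:R - 3%:R * e))) by ring.
by rewrite lerDl !mulr_ge0 //; lra.
Qed.

Lemma sum_agree i x :
  (\sum_(y : {ffun 'I_4 -> 'I_m}) (x i == y i))%N = (m ^ 3)%N.
Proof.
transitivity (\sum_(y : {ffun 'I_4 -> 'I_m})
    \prod_j (if j == i then (x i == y j) : nat else 1))%N.
  apply: eq_bigr => y _; rewrite (bigD1 i) //= eqxx big1 ?muln1 // => j ji.
  by rewrite (negPf ji).
rewrite -(bigA_distr_bigA (fun j a =>
  if j == i then (x i == a) : nat else 1%N)) /=.
rewrite (bigD1 i) //= [X in (X * _)%N](_ : _ = 1%N); last first.
  rewrite eqxx (bigD1 (x i)) //= eqxx big1 // => a.
  by rewrite eq_sym => /negPf->.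
rewrite mul1n (eq_bigr (fun=> m)) => [|j /negPf->]; last first.
  by rewrite sum1_card card_ord.
by rewrite prod_nat_const cardC1 card_ord.
Qed.

(** [second_moment] with [prob_two_places_le] summed over all pairs, divided by
    [mu^2]; what remains decreases in [mu], so a lower bound [mu0] may replace it. *)
Lemma prob_no_isolated_le (mu0 : R) : eps <= 2%:R^-1 -> 0 < mu0 ->
    mu0 <= m%:R ^+ 4 *
      (p ^+ 3 * ((1 - p) ^+ (16 * N) * (1 - p ^+ 2) ^+ (16 * N ^ 2))) ->
  Pr (fun G => ~~ [exists x, A x G]) <=
    6%:R * eps + (4%:R * m%:R ^+ 7 * p ^+ 6 / mu0 ^+ 2 + mu0^-1).
Proof.
move=> eps_half mu0_gt0 mu0_le; have q01 (e : {set V}) := edge_prob01 p01 e.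
pose mu := \sum_x Pr (A x).
have mu_ge : mu0 <= mu.
  apply: le_trans mu0_le _; rewrite -natrX -[X in (_ ^ X)%N](card_ord 4).
  rewrite -[X in (X ^ _)%N]card_ord -card_ffun mulr_natl -sumr_const.
  apply: ler_sum => x _; apply: prob_isolated_K4minus_ge => //.
  exact: place_inj.
have mu_gt0 : 0 < mu by exact: lt_le_trans mu_ge.
have := second_moment q01 (fun x => A x); rewrite -/mu => secm.
have joint : \sum_x \sum_y Pr (fun G => A x G && A y G) <=
    (1 + 6%:R * eps) * mu ^+ 2 + (4%:R * m%:R ^+ 7 * p ^+ 6 + mu).
  apply: (@le_trans _ _ (\sum_x \sum_y
    ((1 + 6%:R * eps) * (Pr (A x) * Pr (A y)) +
      ((\sum_i (x i == y i))%:R * p ^+ 6 + (x == y)%:R * Pr (A x))))).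
    by apply: ler_sum => x _; apply: ler_sum => y _; exact: prob_two_places_le.
  under eq_bigr do rewrite big_split big_split /=.
  rewrite big_split big_split /= lerD ?lerD //.
  - rewrite [mu ^+ 2]expr2 /mu big_distrlr /= mulr_sumr; apply: ler_sum => x _.
    by rewrite mulr_sumr.
  - under eq_bigr => x _.
      rewrite -mulr_suml -natr_sum exchange_big /=.
      under eq_bigr do rewrite sum_agree.
      rewrite sum_nat_const card_ord.
      over.
    rewrite sumr_const card_ffun !card_ord -[_ * _ *+ _]mulr_natl.
    rewrite natrX natrM natrX.
    by rewrite le_eqVlt; apply/orP; left; apply/eqP; ring.
  - apply: ler_sum => x _; rewrite (bigD1 x) //= eqxx mul1r big1 ?addr0 // => y.
    by rewrite eq_sym => /negPf->; rewrite mul0r.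
have bound := le_trans secm (lerB joint (lexx (mu ^+ 2))).
have mu2 : 0 < mu ^+ 2 by rewrite exprn_gt0.
rewrite -(ler_pM2r mu2); apply: le_trans bound _.
have i1 : 1 <= mu / mu0 by rewrite ler_pdivlMr // mul1r.
have i2 : 1 <= (mu / mu0) ^+ 2 by rewrite exprn_ege1.
have K0 : 0 <= 4%:R * m%:R ^+ 7 * p ^+ 6 by rewrite !mulr_ge0 ?exprn_ge0.
set K := 4%:R * _ * _ in K0 *; set e := eps.
rewrite (_ : (6%:R * e + (K / mu0 ^+ 2 + mu0^-1)) * mu ^+ 2 =
  6%:R * e * mu ^+ 2 + (K * (mu / mu0) ^+ 2 + mu * (mu / mu0))); last first.
  by field; rewrite gt_eqF.
have h1 : K <= K * (mu / mu0) ^+ 2 by rewrite ler_peMr.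
have h2 : mu <= mu * (mu / mu0) by rewrite ler_peMr // ltW.
move: h1 h2; generalize (K * (mu / mu0) ^+ 2) (mu * (mu / mu0)) => z1 z2 h1 h2.
lra.
Qed.

End Family.

(** * The random hypergraph G3(n,p) *)

Lemma weight_G3 (R : realType) n (p : R) (G : {set {set 'I_n}}) :
  weight (edge_prob p) G = (uniform3 G)%:R * G3_weight p G.
Proof.
have [/forall_inP G3|] := boolP (uniform3 G).
  rewrite mul1r /weight /G3_weight [RHS]big_mkcond /=.
  apply: eq_bigr => e _; rewrite /edge_prob; case: ifP => [/G3 -> //|_].
  by case: ifP; rewrite ?subr0.
rewrite negb_forall_in => /exists_inP[e eG e3].
by rewrite mul0r /weight (bigD1 e) //= eG /edge_prob (negPf e3) mul0r.
Qed.

Lemma G3_probE (R : realType) n (p : R) (A : pred {set {set 'I_n}}) :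
  G3_prob p A = prob (edge_prob p) A.
Proof.
rewrite /G3_prob big_mkcond; apply: eq_bigr => G _; rewrite weight_G3.
by case: (uniform3 G); case: (A G); rewrite ?mulr1 ?mulr0 ?mul0r ?mul1r.
Qed.

(** The second moment bound for an arbitrary injection of four blocks of [m]
    positions into the vertex set. *)
Lemma G3_prob_nontripartite_ge (R : realType) n m (p mu0 : R) :
    (4 * m <= n)%N -> 0 <= p <= 1 ->
    64%:R * p + 64%:R * n%:R * p ^+ 2 <= 2%:R^-1 -> 0 < mu0 ->
    mu0 <= m%:R ^+ 4 *
      (p ^+ 3 * ((1 - p) ^+ (16 * n) * (1 - p ^+ 2) ^+ (16 * n ^ 2))) ->
  1 - (6%:R * (64%:R * p + 64%:R * n%:R * p ^+ 2) +
       (4%:R * m%:R ^+ 7 * p ^+ 6 / mu0 ^+ 2 + mu0^-1))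
  <= G3_prob p (fun G : {set {set 'I_n}} =>
       [exists H : {set {set 'I_n}}, maximum_F5_free G H && ~~ tripartite H]).
Proof.
move=> mn p01 eps mu0_gt0 mu0_le; rewrite G3_probE.
have mn' : (#|{: 'I_4 * 'I_m}| <= n)%N by rewrite card_prod !card_ord.
pose phi (z : 'I_4 * 'I_m) := widen_ord mn' (enum_rank z).
have phi_inj : injective phi.
  by move=> y z /(congr1 val) /= /val_inj /enum_rank_inj.
have q01 (e : {set 'I_n}) := edge_prob01 p01 e.
set A := (X in prob _ X).
have -> : prob (edge_prob p) A = 1 - prob (edge_prob p) (fun G => ~~ A G).
  by rewrite probC subKr.
rewrite lerD2l lerN2.
have := @prob_no_isolated_le _ _ p m phi p01 phi_inj mu0.
rewrite card_ord => /(_ eps mu0_gt0 mu0_le); apply: le_trans.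
apply: prob_le => // G; apply: contra => /existsP[x xG].
by apply: isolated_K4minus_nontripartite xG; exact: place_inj.
Qed.

(** * Asymptotics for p = 0.1 sqrt(ln n)/n *)

Section Asymptotics.
Variable R : realType.
Implicit Types (s t u : R).

Lemma expRN_le_1B u : 0 <= u <= 2%:R^-1 -> expR (- (2%:R * u)) <= 1 - u.
Proof.
move=> /andP[u0 u1]; rewrite expRN.
have e1 : 1 + 2%:R * u <= expR (2%:R * u) := expR_ge1Dx _.
have e0 : 0 < 1 + 2%:R * u by lra.
apply: (@le_trans _ _ (1 + 2%:R * u)^-1).
  by rewrite lef_pV2 ?posrE // expR_gt0.
by rewrite -[_^-1]mul1r ler_pdivrMr //; nra.
Qed.

Lemma expRN_le_1BX u k : 0 <= u <= 2%:R^-1 ->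
  expR (- (2%:R * u * k%:R)) <= (1 - u) ^+ k.
Proof.
move=> u01; rewrite -mulNr expRM_natr; apply: lerXn2r (expRN_le_1B u01).
  by rewrite nnegrE expR_ge0.
by rewrite nnegrE; lra.
Qed.

(** With [s = sqrt (ln n)] and [t = s^2]: the expectation is at least
    [mu0 = s^3 exp(0.68 t - 3.2 s) / K], where [K] collects [(n/m)^4 <= 8^4] and
    the factor [10^3] from [p^3]. The error from disjoint pairs is
    [O(s^2 / n)], that from pairs sharing a vertex is
    [O(n / exp(1.36 t - 6.4 s)) = O(exp(-(0.36 t - 6.4 s)))], and [1/mu0] is
    smaller still; [s >= 40] makes [0.36 t - 6.4 s >= 0.2 t], so that all are
    [O(1/t)]. *)
Lemma G3_nontripartite_rate n s (K := 8%:R ^+ 4 * 10%:R ^+ 3 : R) :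
    40%:R <= s -> n%:R = expR (s ^+ 2) ->
  1 - (200%:R + (20%:R * K ^+ 2 + K)) / s ^+ 2 <=
  G3_prob (10%:R^-1 * s / n%:R) (fun G : {set {set 'I_n}} =>
       [exists H : {set {set 'I_n}}, maximum_F5_free G H && ~~ tripartite H]).
Proof.
move=> s40; set N : R := n%:R => NE; set p := 10%:R^-1 * s / N.
have s0 : 0 < s by lra.
have s2 : 0 < s ^+ 2 by rewrite exprn_gt0.
have N0 : 0 < N by rewrite NE expR_gt0.
have N_ge : (s ^+ 2) ^+ 2 / 2%:R <= N.
  by rewrite NE; apply: le_trans (expR_ge1Dxn 1 (ltW s2)); rewrite lerDr.
have s_le : 40%:R * s <= s ^+ 2 by rewrite expr2 ler_wpM2r // ltW.
have s2_ge : 1600%:R <= s ^+ 2 by lra.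
have s4_ge : 1600%:R * s ^+ 2 <= (s ^+ 2) ^+ 2.
  by rewrite [leRHS]expr2 ler_wpM2r // ltW.
have N_ge_s : s <= N by lra.
have n4 : (4 <= n)%N by rewrite -(ler_nat R) -/N; lra.
have K0 : 0 < K by rewrite mulr_gt0 // exprn_gt0.
have pN : p * N = s / 10%:R by rewrite /p; field; rewrite gt_eqF.
have p0 : 0 < p by rewrite !mulr_gt0 // invr_gt0.
have p_half : p <= 10%:R^-1.
  by rewrite -(ler_pM2r N0) pN; lra.
pose m := (n %/ 4)%N.
have mn : (4 * m <= n)%N by rewrite mulnC leq_trunc_div.
have m_le : m%:R <= N by rewrite ler_nat (leq_trans _ mn) // leq_pmull.
have m_ge : N / 8%:R <= m%:R.
  rewrite ler_pdivrMr // -natrM ler_nat /m.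
  rewrite {1}(divn_eq n 4) -[8%N]/(4 + 4)%N mulnDr leq_add2l.
  rewrite (leq_trans (ltnW (ltn_pmod n (isT : 0 < 4)%N))) //.
  by rewrite leq_pmull // divn_gt0.
(* exponents of the pendant and cherry factors: 2 * 16 n p and 2 * 16 n^2 p^2 *)
pose a := 16%:R / 5%:R * s; pose b := 8%:R / 25%:R * s ^+ 2.
pose E := expR (s ^+ 2 - a - b).
have E1 : 1 <= E.
  apply: le_trans (expR_ge1Dx _); rewrite lerDl /a /b; nra.
pose mu0 := s ^+ 3 * E / K.
have mu0_gt0 : 0 < mu0 by rewrite divr_gt0 // mulr_gt0 ?expR_gt0 // exprn_gt0.
have mu0_le : mu0 <= m%:R ^+ 4 *
    (p ^+ 3 * ((1 - p) ^+ (16 * n) * (1 - p ^+ 2) ^+ (16 * n ^ 2))).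
  have -> : mu0 = (N / 8%:R) ^+ 4 * (p ^+ 3 * (expR (- a) * expR (- b))).
    rewrite /mu0 /E !expRD -NE /p /K; field.
    by rewrite gt_eqF.
  have ea : expR (- a) <= (1 - p) ^+ (16 * n).
    have -> : a = 2%:R * p * (16 * n)%:R.
      by rewrite natrM -/N /a /p; field; rewrite gt_eqF.
    by apply: expRN_le_1BX; lra.
  have eb : expR (- b) <= (1 - p ^+ 2) ^+ (16 * n ^ 2).
    have -> : b = 2%:R * p ^+ 2 * (16 * n ^ 2)%:R.
      by rewrite natrM natrX -/N /b /p; field; rewrite gt_eqF.
    by apply: expRN_le_1BX; nra.
  have N8 : 0 <= N / 8%:R by rewrite divr_ge0 // ltW.
  have p3 : 0 <= p ^+ 3 by rewrite exprn_ge0 // ltW.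
  apply: ler_pM; first exact: exprn_ge0.
  - by rewrite mulr_ge0 // mulr_ge0 // expR_ge0.
  - by rewrite lerXn2r ?nnegrE ?ler0n.
  by rewrite ler_wpM2l // ler_pM ?expR_ge0.
have eps : 64%:R * p + 64%:R * N * p ^+ 2 <= 15%:R / s ^+ 2.
  rewrite ler_pdivlMr // -(ler_pM2r N0).
  rewrite [leLHS](_ : _ =
    (64%:R * (p * N) + 64%:R * (p * N) ^+ 2) * s ^+ 2); last by ring.
  rewrite pN.
  apply: (@le_trans _ _ (15%:R * ((s ^+ 2) ^+ 2 / 2%:R))); last first.
    by rewrite ler_wpM2l.
  rewrite (_ : 15%:R * _ = (15%:R / 2%:R * s ^+ 2) * s ^+ 2); last by field.
  rewrite ler_wpM2r ?(ltW s2) //; nra.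
have eps_half : 64%:R * p + 64%:R * N * p ^+ 2 <= 2%:R^-1.
  apply: le_trans eps _; rewrite ler_pdivrMr //; lra.
have p01 : 0 <= p <= 1 by lra.
apply: le_trans (G3_prob_nontripartite_ge mn p01 eps_half mu0_gt0 mu0_le).
rewrite lerD2l lerN2 [leRHS]mulrDl [X in _ <= _ + X]mulrDl.
apply: lerD; last apply: lerD.
- apply: (@le_trans _ _ (6%:R * (15%:R / s ^+ 2))); first by rewrite ler_wpM2l.
  by rewrite mulrA ler_wpM2r ?invr_ge0 ?(ltW s2) // -natrM ler_nat.
- have NE2 : N / E ^+ 2 <= 5%:R / s ^+ 2.
    rewrite NE /E -expRM_natl -expRN -expRD.
    have : 1 + s ^+ 2 / 5%:R <= expR (s ^+ 2 / 5%:R) := expR_ge1Dx _.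
    move=> h; apply: (@le_trans _ _ (expR (- (s ^+ 2 / 5%:R)))).
      by rewrite ler_expR /a /b; nra.
    rewrite expRN -[leLHS]mul1r ler_pdivrMr ?expR_gt0 //.
    rewrite mulrAC ler_pdivlMr // mul1r.
    apply: (@le_trans _ _ (5%:R * (1 + s ^+ 2 / 5%:R))); first by lra.
    by rewrite ler_wpM2l.
  apply: (@le_trans _ _ (4%:R * N ^+ 7 * p ^+ 6 / mu0 ^+ 2)).
    rewrite ler_wpM2r ?invr_ge0 ?exprn_ge0 ?(ltW mu0_gt0) //.
    rewrite ler_wpM2r ?exprn_ge0 ?(ltW p0) // ler_wpM2l //.
    by apply: lerXn2r; rewrite ?nnegrE ?ler0n.
  rewrite (_ : _ / _ = 4%:R / 10%:R ^+ 6 * K ^+ 2 * (N / E ^+ 2)); last first.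
    rewrite /mu0 /p; field.
    by rewrite !gt_eqF // expR_gt0.
  rewrite (_ : 20%:R * _ / _ = 4%:R * K ^+ 2 * (5%:R / s ^+ 2)); last first.
    by field; rewrite gt_eqF.
  apply: ler_pM => //; first by rewrite mulr_ge0 ?exprn_ge0 ?(ltW K0).
    by rewrite divr_ge0 ?exprn_ge0 ?expR_ge0 ?(ltW N0).
  rewrite ler_wpM2r ?exprn_ge0 ?(ltW K0) //.
  by rewrite ler_pdivrMr ?exprn_gt0 // ler_peMr // exprn_ege1 // ler1n.
- rewrite /mu0 invf_div ler_wpM2l ?(ltW K0) //.
  rewrite lef_pV2 ?posrE // ?mulr_gt0 ?exprn_gt0 ?expR_gt0 //.
  rewrite [s ^+ 3]exprSr -mulrA ler_peMr ?(ltW s2) //.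
  by rewrite -[leLHS]mulr1; apply: ler_pM => //; lra.
Qed.

End Asymptotics.

Theorem mainTheorem2 (R : realType) :
  with_high_probability
    (fun n : nat => 10%:R^-1 * Num.sqrt (ln (n%:R : R)) / n%:R)
    (fun (n : nat) (G : {set {set 'I_n}}) =>
      [exists H : {set {set 'I_n}}, maximum_F5_free G H && ~~ tripartite H]).
Proof.
rewrite /with_high_probability.
pose K : R := 8%:R ^+ 4 * 10%:R ^+ 3.
pose C := 200%:R + (20%:R * K ^+ 2 + K).
have C0 : 0 < C by rewrite !addr_gt0 ?mulr_gt0 ?exprn_gt0 ?mulr_gt0 ?exprn_gt0.
apply/cvgrPdist_le => e e0; near=> n.
set s := Num.sqrt _.
have n_ge : expR (40%:R ^+ 2 + C / e) <= n%:R by near: n; exact: nbhs_infty_ger.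
have n0 : 0 < n%:R :> R := lt_le_trans (expR_gt0 _) n_ge.
have ln_ge : 40%:R ^+ 2 + C / e <= ln n%:R.
  by rewrite -[leLHS]expRK ler_ln ?posrE ?expR_gt0.
have Ce : 0 < C / e by rewrite divr_gt0.
have ln0 : 0 <= ln (n%:R : R).
  by apply: le_trans ln_ge; rewrite addr_ge0 ?exprn_ge0 // ltW.
have sE : s ^+ 2 = ln n%:R by rewrite sqr_sqrtr.
have s40 : 40%:R <= s.
  rewrite -(@ler_pXn2r _ 2) ?nnegrE ?sqrtr_ge0 // sE; lra.
have nE : n%:R = expR (s ^+ 2) by rewrite sE lnK.
have rate := G3_nontripartite_rate s40 nE.
have p01 : 0 <= 10%:R^-1 * s / n%:R <= 1.
  have s0 : 0 < s by lra.
  rewrite divr_ge0 ?mulr_ge0 ?(ltW s0) //= ler_pdivrMr // mul1r nE.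
  by apply: le_trans (expR_ge1Dx _); nra.
have le1 (A : pred {set {set 'I_n}}) : G3_prob (10%:R^-1 * s / n%:R) A <= 1.
  by rewrite G3_probE; apply: prob_le1 => e'; exact: edge_prob01.
rewrite ger0_norm ?subr_ge0 ?le1 // lerBlDr -lerBlDl.
apply: le_trans rate; rewrite -/K -/C lerD2l lerN2 sE.
rewrite ler_pdivrMr; last by lra.
rewrite mulrC -ler_pdivrMr //; lra.
Unshelve. all: by end_near.
Qed.
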